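(* Let $\Delta$ be a positive integer and let $G$ be a connected weighted triangle-free graph with weights $w:E(G)\to\mathbb{R}_+$ and maximum degree $\Delta(G)\le\Delta$. Then $\mathrm{mac}(G)\ge t_\Delta\, w(G)$, where $t_\Delta=\frac12+\frac{3\Delta-1}{4\Delta^2+2\Delta-2}$.
   Context: $\mathbb{R}_+$ denotes the non-negative reals; $w(G)$ is the sum of all edge weights. $\mathrm{mac}(G)$ is the maximum total weight of the edges between $A$ and $B$ over all partitions $(A,B)$ of $V(G)$. Triangle-free means containing no $K_3$ subgraph. *)

(* Defs.v *)
From mathcomp Require Import all_boot all_order all_algebra.
From mathcomp Require Import reals.

Set Implicit Arguments.
Unset Strict Implicit.
Unset Printing Implicit Defensive.

Import Order.TTheory GRing.Theory Num.Theory.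
Local Open Scope ring_scope.

Record sgraph := SGraph {
  vertex :> finType;
  adj : rel vertex;
  adj_sym : symmetric adj;
  adj_irrefl : irreflexive adj
}.

Section Graph.
Variable G : sgraph.

Definition edges : {set {set G}} :=
  [set [set p.1; p.2] | p : G * G & adj p.1 p.2].

Definition neighbours (x : G) : {set G} := [set y | adj x y].

Definition max_degree : nat := \max_(x : G) #|neighbours x|.

(* The graph with no vertices counts as connected. *)
Definition connected : Prop := forall x y : G, connect (@adj G) x y.

Definition triangle_free : Prop :=
  forall x y z : G, ~~ [&& adj x y, adj y z & adj x z].

Section Weight.
Variables (R : realType) (w : {set G} -> R).

(* Only the values of [w] on [edges] matter in what follows. *)
Definition nonneg_weights : Prop := forall f, f \in edges -> 0 <= w f.

Definition total_weight : R := \sum_(f in edges) w f.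

Definition between (A B : {set G}) (f : {set G}) : bool :=
  [exists x in A, exists y in B, f == [set x; y]].

Definition cut_weight (A B : {set G}) : R :=
  \sum_(f in edges | between A B f) w f.

(* A partition (A, B) of the vertex set is a pair (A, ~: A), where a part may be
   empty. The cut of [A = set0] has weight 0, so the default value 0 does not
   affect the maximum. *)
Definition mac : R := \big[Num.max/0]_(A : {set G}) cut_weight A (~: A).

End Weight.
End Graph.

Definition t_bound (R : realType) (D : nat) : R :=
  1 / 2 + (3 * D%:R - 1) / (4 * D%:R ^+ 2 + 2 * D%:R - 2).

(* Main.v *)
(* Random flips: if V(G) is partitioned into clusters each inducing a bipartite
   graph, flip a 2-colouring of each cluster independently with probability 1/2.
   Edges inside clusters (total weight w(F)) are always cut, the other ones with
   probability 1/2, so mac(G) >= (w(G) + w(F)) / 2.  By Vizing's theorem some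
   matching M has w(M) >= w(G) / (D + 1).  Contracting M gives a simple graph of
   maximum degree at most 2 D - 2, so again by Vizing some matching of it carries
   at least a 1 / (2 D - 1) fraction of w(G) - w(M).  Both matchings together form
   clusters of at most 4 vertices, which are bipartite since G is triangle-free. *)
Require Import Defs.
From mathcomp Require Import all_boot all_order all_algebra.
From mathcomp Require Import perm.
From mathcomp Require Import reals ring lra.

Set Implicit Arguments.
Unset Strict Implicit.
Unset Printing Implicit Defensive.

Import Order.TTheory GRing.Theory Num.Theory.

(** * Paths in graphs of maximum degree 2 *)

Section Paths.
Variable T : finType.
Implicit Types e r : rel T.

Lemma path_mono_in e e' x p :
    (forall u v, u \in x :: p -> v \in p -> e u v -> e' u v) ->
  path e x p -> path e' x p.
Proof.
elim: p x => //= y p IHp x sub_e /andP[exy yp].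
rewrite sub_e ?mem_head //=; apply: IHp => // u v up vp.
by apply: sub_e; rewrite inE (up, vp) orbT.
Qed.

(** Cut the path at its first vertex in [Q]: all earlier steps leave vertices outside [Q]. This lets
    a fan survive a recolouring that harms only steps leaving [Q]. *)
Lemma connect_until e e' (Q : pred T) x y :
    (forall u v, ~~ Q u -> e u v -> e' u v) -> connect e x y -> Q y ->
  exists2 z, connect e' x z & Q z.
Proof.
move=> sub_e /connectP[p xp ->]; elim: p x xp => [|z p IHp] x /=.
  by exists x.
case/andP=> exz zp Qlast; have [Qx|nQx] := boolP (Q x); first by exists x.
have [t zt Qt] := IHp z zp Qlast; exists t => //.
exact: connect_trans (connect1 (sub_e _ _ nQx exz)) zt.
Qed.

(** Degree at most 1; isolated vertices count as endpoints. *)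
Definition endpoint r u := forall a b, r u a -> r u b -> a = b.

Section Degree2.
Variable r : rel T.
Hypothesis sym_r : symmetric r.
Hypothesis deg2 : forall u a b c, r u a -> r u b -> r u c ->
  [\/ a = b, a = c | b = c].

(** Here [w] is the vertex just left behind. With degree at most 2 the next vertex is forced, so
    both paths advance together; when one stops at an endpoint, [w] is its only neighbour and the
    other must stop too. *)
Lemma endpoint_path_unique u w p q :
    r u w -> w \notin p -> w \notin q -> path r u p -> path r u q ->
    uniq (u :: p) -> uniq (u :: q) ->
    endpoint r (last u p) -> endpoint r (last u q) ->
  last u p = last u q.
Proof.
elim: p u w q => [|a p IHp] u w [|b q] //= ruw.
- by move=> _ /[!inE] /norP[/eqP wb _] _ /andP[rub _] _ _ /(_ w b ruw rub).
- by move=> /[!inE] /norP[/eqP wa _] _ /andP[rua _] _ _ _ _ /(_ w a ruw rua).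
rewrite !inE => /norP[/eqP wa _] /norP[/eqP wb _].
case/andP=> rua ap /andP[rub bq].
case/andP=> /norP[_ up] Uap /andP[/norP[_ uq] Ubq].
have [//|//|ab] := deg2 ruw rua rub; rewrite -{}ab in bq Ubq *.
by apply: IHp up uq _ _ _ _ => //; rewrite sym_r.
Qed.

(** A component of maximum degree 2 is a path or a cycle, so it has at most two endpoints. Both
    paths start with the only neighbour of [x]. *)
Lemma component_endpoints x y z :
    endpoint r x -> endpoint r y -> endpoint r z -> x != y -> x != z ->
  connect r x y -> connect r x z -> y = z.
Proof.
move=> endx endy endz xy xz /connectP[p0 p0P Dy] /connectP[q0 q0P Dz].
move: endy endz xy xz; rewrite {y}Dy {z}Dz.
case/shortenP: p0P => p xp Up _; case/shortenP: q0P => q xq Uq _.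
move=> endp endq xNp xNq.
case: p xp Up endp xNp => [|a p] /=; first by rewrite eqxx.
case: q xq Uq endq xNq => [|b q] /=; first by rewrite eqxx.
case/andP=> rxb bq /andP[xq Ubq] endq _ /andP[rxa ap] /andP[xp Uap] endp _.
rewrite -{b rxb}(endx a b rxa rxb) in bq xq Ubq endq *.
move: xp xq; rewrite !inE => /norP[_ xp] /norP[_ xq].
by apply: endpoint_path_unique xp xq _ _ _ _ _ _; rewrite // sym_r.
Qed.

End Degree2.
End Paths.

(** * Vizing's theorem *)

Section EdgeColouring.
Variables T K : finType.
Implicit Types (c : T -> T -> option K) (x y u v : T) (a b i : K).

(** The coloured graph is encoded in [c] itself: [None] stands for a pair that is not an edge or is
    not yet coloured. *)
Definition proper_colouring c :=
  [/\ forall u v, c u v = c v u, forall u, c u u = None &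
  forall u v w i, c u v = Some i -> c u w = Some i -> v = w].

Definition missing c i u := [forall v, c u v != Some i].

Definition same_pair x y u v := (u == x) && (v == y) || (u == y) && (v == x).

Definition recolour c x y o u v := if same_pair x y u v then o else c u v.

Lemma missingP c i u : reflect (forall v, c u v <> Some i) (missing c i u).
Proof. by apply: (iffP forallP) => h v; apply/eqP/h. Qed.

Lemma same_pairC x y u v : same_pair x y u v = same_pair x y v u.
Proof. by rewrite /same_pair orbC andbC [X in _ || X]andbC. Qed.

Lemma proper_uncolour c x y :
  proper_colouring c -> proper_colouring (recolour c x y None).
Proof.
rewrite /recolour => -[symc irrc injc]; split=> [u v|u|u v w i].
- by rewrite same_pairC symc.
- by case: ifP.
by case: ifP => // _; case: ifP => // _; apply: injc.
Qed.

Lemma proper_recolour c x y i : proper_colouring c -> x != y ->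
  missing c i x -> missing c i y -> proper_colouring (recolour c x y (Some i)).
Proof.
rewrite /recolour => -[symc irrc injc] xy /missingP mx /missingP my.
split=> [u v|u|u v w j]; first by rewrite same_pairC symc.
  by case: ifP => // /orP[]/andP[/eqP-> /eqP exy]; rewrite exy eqxx in xy.
rewrite /same_pair; case: ifPn => [puv [<-]|npuv cuv].
  case: ifPn => [puw _|_ cuw].
    by case/orP: puv puw => /andP[/eqP-> /eqP->];
      rewrite ?eqxx ?(eq_sym y x) (negPf xy) /= ?orbF => /eqP.
  by case/orP: puv => /andP[/eqP eu _]; rewrite eu in cuw; [case: (mx w)|case: (my w)].
case: ifPn => [puw [ij]|_ cuw]; last exact: injc cuv cuw.
rewrite -ij in cuv.
by case/orP: puw => /andP[/eqP eu _]; rewrite eu in cuv; [case: (mx v)|case: (my v)].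
Qed.

(** A step from [u] to [v] says that [u] can accept the colour of the edge from [x] to [v] on its
    own edge to [x], once that colour is released. *)
Definition fan c x : rel T :=
  fun u v => if c x v is Some i then missing c i u else false.

(* Shift the colours one step down along the fan, which frees the edge from [x]
   to the last vertex; that edge then takes the colour [a]. *)
Lemma fan_rotate c x y a p : proper_colouring c -> x != y -> c x y = None ->
    path (fan c x) y p -> uniq (y :: p) -> missing c a x -> missing c a (last y p) ->
  exists2 c', proper_colouring c' &
    forall u v, c' u v = (same_pair x y u v || c u v) :> bool.
Proof.
elim: p c y => [|z p IHp] c y propc xy cxy /=.
  move=> _ _ max may; exists (recolour c x y (Some a)).
    exact: proper_recolour.
  by move=> u v; rewrite /recolour; case: ifP.
case/andP=> fyz zp /and3P[yp zNp Up] max mal.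
have [symc irrc injc] := propc.
move: fyz; rewrite /fan; case cxz: (c x z) => [i|//] miy.
(* [c2] moves the colour [i] from the edge [x z] to [x y], so [z] takes over the role of [y] in the
   induction. *)
pose c1 := recolour c x z None; pose c2 := recolour c1 x y (Some i).
have xz : x != z by apply: contraPneq cxz => <-; rewrite irrc.
have yz : y != z by apply: contraNneq yp => ->; rewrite mem_head.
have sub1 j u : missing c j u -> missing c1 j u.
  by move=> /missingP mju; apply/missingP => v; rewrite /c1 /recolour; case: ifP.
have propc2 : proper_colouring c2.
  apply: proper_recolour => //; [exact: proper_uncolour | | exact: sub1].
  apply/missingP => v; rewrite /c1 /recolour /same_pair eqxx (negPf xz) orbF /=.
  by case: eqP => // vz cxv; apply: vz; apply: injc cxv cxz.
have c2x v : v != y -> v != z -> c2 x v = c x v.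
  move=> vy vz; rewrite /c2 /c1 /recolour /same_pair eqxx.
  by rewrite (negPf vy) (negPf vz) (negPf xy) (negPf xz).
have sub2 j u : u != x -> u != y -> missing c j u -> missing c2 j u.
  move=> ux uy /sub1/missingP mju; apply/missingP => v.
  by rewrite /c2 /recolour /same_pair (negPf ux) (negPf uy) /=; apply: mju.
have c2xz : c2 x z = None.
  by rewrite /c2 /c1 /recolour /same_pair !eqxx /= eq_sym (negPf yz) (negPf xy).
have Nx : x \notin z :: p.
  rewrite inE (negPf xz) /=; apply/negP => xp.
  have : forall u q, path (fan c x) u q -> x \notin q.
    move=> u q; elim: q u => //= t q IHq u /andP[fut /IHq xq].
    rewrite inE (negPf xq) orbF; apply: contraL fut => /eqP <-.
    by rewrite /fan irrc.
  by move/(_ z p zp); rewrite xp.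
have Ny : y \notin z :: p by [].
have [||||c' propc' domc'] := IHp c2 z propc2 xz c2xz.
(* The rest of the fan remains a fan for [c2]: only [x] and [y] can lose a missing colour, and
   neither lies on it. *)
- apply: path_mono_in zp => u v up vp.
  have vy : v != y by apply: contraNneq Ny => <-; rewrite inE vp orbT.
  have vz : v != z by apply: contraNneq zNp => <-.
  rewrite /fan c2x //; case: (c x v) => // j; apply: sub2.
    by apply: contraNneq Nx => <-.
  by apply: contraNneq Ny => <-.
- by rewrite /= zNp.
- apply/missingP => v; rewrite /c2 /c1 /recolour.
  case: ifP => _ => [[ia]|]; last by case: ifP => _ //; apply: (missingP _ _ _ max).
  by move/missingP: max => /(_ z); rewrite cxz ia.
- apply: sub2 => //.
    by apply: contraNneq Nx => <-; apply: mem_last.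
  by apply: contraNneq Ny => <-; apply: mem_last.
exists c' => // u v; rewrite domc' /c2 /c1 /recolour.
case: (same_pair x y u v) => /=; first by rewrite orbT.
case pz: (same_pair x z u v) => //=.
by case/orP: pz => /andP[/eqP-> /eqP->]; rewrite 1?[c z x]symc cxz.
Qed.

(** * Kempe changes *)

Definition kempe_edge c a b : rel T :=
  fun u v => (c u v == Some a) || (c u v == Some b).

Definition kempe_swap c a b x u v :=
  if connect (kempe_edge c a b) x u then omap (tperm a b) (c u v) else c u v.

Lemma kempe_edge_sym c a b : proper_colouring c -> symmetric (kempe_edge c a b).
Proof. by case=> symc _ _ u v; rewrite /kempe_edge symc. Qed.

(** Testing only the first end of an edge is harmless: an edge coloured [a] or [b] has both ends in
    the same component, and any other colour is fixed by the transposition. *)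
Lemma proper_kempe_swap c a b x :
  proper_colouring c -> proper_colouring (kempe_swap c a b x).
Proof.
move=> propc; have [symc irrc injc] := propc.
have symk := sym_connect_sym (kempe_edge_sym a b propc).
rewrite /kempe_swap; split=> [u v|u|u v w i].
- rewrite (symc v u); case cuv: (c u v) => [i|] /=; last by rewrite !if_same.
  have [abi | nabi] := boolP (kempe_edge c a b u v).
    by rewrite ![connect _ x _]symk (same_connect symk (connect1 abi)).
  move: nabi; rewrite /kempe_edge cuv => /norP[/eqP ia /eqP ib].
  by rewrite tpermD ?if_same //; apply/eqP => E; [apply: ia|apply: ib]; rewrite E.
- by rewrite irrc if_same.
case: ifP => _; last exact: injc.
case cuv: (c u v) => [j|//] [<-]; case cuw: (c u w) => [l|//] [] /perm_inj lj.
by apply: injc cuv _; rewrite cuw lj.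
Qed.

Lemma missing_kempe_swap c a b x i u : connect (kempe_edge c a b) x u ->
  missing (kempe_swap c a b x) (tperm a b i) u = missing c i u.
Proof.
move=> xu; apply: eq_forallb => v; rewrite /kempe_swap xu.
by case: (c u v) => //= j; rewrite !(inj_eq Some_inj) (inj_eq perm_inj).
Qed.

Lemma missing_kempe_swap_out c a b x i u : ~~ connect (kempe_edge c a b) x u ->
  missing (kempe_swap c a b x) i u = missing c i u.
Proof. by move/negPf => xu; apply: eq_forallb => v; rewrite /kempe_swap xu. Qed.

Definition extends c x y c' := proper_colouring c' /\
  forall u v, c' u v = (same_pair x y u v || c u v) :> bool.

Lemma fan_connect c x y a u : proper_colouring c -> x != y -> c x y = None ->
    connect (fan c x) y u -> missing c a x -> missing c a u ->
  exists c', extends c x y c'.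
Proof.
move=> propc xy cxy /connectP[p0 p0P ->] max.
case/shortenP: p0P => p yp Up _ mal.
by have [c' ? ?] := fan_rotate propc xy cxy yp Up max mal; exists c'.
Qed.

(* After swapping [a] and [b] in the component of [u], follow the fan only up to
   its first vertex of that component missing [b]: no earlier step is affected. *)
Lemma fan_swap c x y a b u : proper_colouring c -> x != y -> c x y = None ->
    connect (fan c x) y u -> missing c a x -> missing c b u ->
    ~~ connect (kempe_edge c a b) u x ->
  exists c', extends c x y c'.
Proof.
move=> propc xy cxy yu max mbu Nux; pose c' := kempe_swap c a b u.
pose Q v := connect (kempe_edge c a b) u v && missing c b v.
have c'x v : c' x v = c x v by rewrite /c' /kempe_swap (negPf Nux).
have [|||z yz /andP[uz mbz]] := @connect_until _ (fan c x) (fan c' x) Q y u.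
- move=> v w; rewrite /Q /fan c'x; case cxw: (c x w) => [i|//] NQ miv.
  have [uv|Nuv] := boolP (connect (kempe_edge c a b) u v); last first.
    by rewrite missing_kempe_swap_out.
  rewrite uv /= in NQ.
  (* The swap fixes [i]: [v] misses [i] but not [b], and [i] occurs at [x], which misses [a]. *)
  have ib : b != i by apply: contraNneq NQ => ->.
  have ia : a != i.
    by apply/eqP => E; move/missingP: max => /(_ w); rewrite cxw E.
  by rewrite -(tpermD ia ib) missing_kempe_swap.
- exact: yu.
- by rewrite /Q connect0.
have propc' := proper_kempe_swap a b u propc.
have [|||c'' [propc'' domc'']] := fan_connect propc' xy _ yz (a := a).
- by rewrite -/c' c'x.
- by rewrite missing_kempe_swap_out.
- by have := missing_kempe_swap b uz; rewrite tpermR => ->.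
exists c''; split=> // v w; rewrite domc'' /kempe_swap.
by case: ifP => // _; case: (c v w).
Qed.

Lemma missing_exists c u : proper_colouring c ->
  #|[set v | c u v]| < #|K| -> exists i, missing c i u.
Proof.
case=> _ _ injc degu; apply/existsP; apply: contraLR degu.
rewrite negb_exists -leqNgt => /forallP nomiss.
have ex i : exists v, c u v == Some i.
  have := nomiss i; rewrite negb_forall => /existsP[v]; rewrite negbK.
  by exists v.
pose g i := xchoose (ex i).
have gE i : c u (g i) = Some i by apply/eqP/(xchooseP (ex i)).
have inj_g : injective g by move=> i j gij; apply: Some_inj; rewrite -!gE gij.
rewrite -cardsT -(card_imset _ inj_g); apply/subset_leq_card/subsetP => v.
by case/imsetP=> i _ ->; rewrite inE gE.
Qed.

(* If no vertex of the fan component [S] of [y] shares a missing colour with [x],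
   the missing colours chosen in [S] all occur on edges from [x] to [S :\ y], so
   two vertices of [S] miss the same colour [b]; as [x] misses [a], these three
   vertices cannot lie on the same path coloured with [a] and [b]. *)
Lemma vizing_extend c x y : proper_colouring c -> x != y -> c x y = None ->
  (forall u, #|[set v | c u v]| < #|K|) -> exists c', extends c x y c'.
Proof.
move=> propc xy cxy deg; have [symc irrc injc] := propc.
have symk a b := sym_connect_sym (kempe_edge_sym a b propc).
pose S := [set u | connect (fan c x) y u].
have yS : y \in S by rewrite inE.
have [/existsP[u /existsP[i /and3P[]]]|noshare] :=
  boolP [exists u, exists i, [&& u \in S, missing c i u & missing c i x]].
  by rewrite inE => yu miu mix; apply: fan_connect yu mix miu.
have ex_free u : exists i, missing c i u by apply: missing_exists.
pose free u := xchoose (ex_free u).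
have freeP u : missing c (free u) u by apply: (xchooseP (ex_free u)).
have next u : u \in S -> exists v, c x v == Some (free u).
  move=> uS; apply/existsP; apply: contraR noshare; rewrite negb_exists => mx.
  by apply/existsP; exists u; apply/existsP; exists (free u); rewrite uS freeP.
pose g u := odflt u [pick v | c x v == Some (free u)].
have gE u : u \in S -> c x (g u) = Some (free u).
  move=> /next[v cxv]; rewrite /g; case: pickP => [w /eqP //|/(_ v)].
  by rewrite cxv.
have gS : g @: S \subset S :\ y.
  apply/subsetP => _ /imsetP[u uS ->]; rewrite !inE; apply/andP; split.
    by apply: contra_eq_neq (gE u uS) => ->; rewrite cxy.
  have cgu := gE u uS; rewrite inE in uS.
  apply: connect_trans uS (connect1 _).
  by rewrite /fan cgu; apply: freeP.
have : ~~ dinjectiveb g S.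
  apply: contraL (subset_leq_card gS) => /dinjectiveP inj_g.
  by rewrite -ltnNge card_in_imset // (cardsD1 y S) yS.
case/dinjectivePn=> u uS [v /andP[/= vu vS] guv].
have fuv : free u = free v by apply: Some_inj; rewrite -!gE // guv.
have xS w : w \in S -> x != w.
  rewrite inE => /connectP[p yp ->]; elim/last_ind: p yp => //= p z _.
  rewrite rcons_path last_rcons => /andP[_]; apply: contraL => /eqP <-.
  by rewrite /fan irrc.
pose a := free x; pose b := free u; have max : missing c a x := freeP x.
pose r := kempe_edge c a b.
have deg2 t t1 t2 t3 : r t t1 -> r t t2 -> r t t3 ->
    [\/ t1 = t2, t1 = t3 | t2 = t3].
  by case/orP=> /eqP e1 /orP[]/eqP e2 /orP[]/eqP e3;
    do [ exact: Or31 (injc _ _ _ _ e1 e2) | exact: Or32 (injc _ _ _ _ e1 e3)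
       | exact: Or33 (injc _ _ _ _ e2 e3)].
have enda t : missing c a t -> endpoint r t.
  move/missingP => mat t1 t2 /orP[]/eqP e1; first by case: (mat t1).
  by case/orP=> /eqP e2; [case: (mat t2) | exact: injc e1 e2].
have endb t : missing c b t -> endpoint r t.
  move/missingP => mbt t1 t2 /orP[]/eqP e1; last by case: (mbt t1).
  by case/orP=> /eqP e2; [exact: injc e1 e2 | case: (mbt t2)].
have mbu : missing c b u := freeP u.
have mbv : missing c b v by rewrite /b fuv.
have [xu|xNu] := boolP (connect r x u); last first.
  by rewrite inE in uS; apply: fan_swap uS max mbu _ => //; rewrite -/r symk.
have [xv|xNv] := boolP (connect r x v); last first.
  by rewrite inE in vS; apply: fan_swap vS max mbv _ => //; rewrite -/r symk.
case/eqP: vu; apply/esym; apply: component_endpoints xu xv => //.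
- exact: kempe_edge_sym.
- exact: enda.
- exact: endb.
- exact: endb.
- exact: xS.
- exact: xS.
Qed.

(** Induction on the number of adjacent ordered pairs: delete one edge, colour the rest, and put the
    edge back by [vizing_extend]. *)
Theorem vizing (e : rel T) : symmetric e -> irreflexive e ->
    (forall u, #|[set v | e u v]| < #|K|) ->
  exists2 c, proper_colouring c & forall u v, c u v = e u v :> bool.
Proof.
move: {2}_.+1 (ltnSn #|[set p | e p.1 p.2]|) => n.
elim: n e => // n IHn e le_n sym_e irr_e deg.
have [/existsP[x /existsP[y exy]]|none] :=
  boolP [exists x, exists y, e x y]; last first.
  exists (fun _ _ => None); first by split.
  move=> u v; apply/esym; apply: contraNF none => euv.
  by apply/existsP; exists u; apply/existsP; exists v.
have xy : x != y by apply: contraTneq exy => ->; rewrite irr_e.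
pose e' u v := ~~ same_pair x y u v && e u v.
have [||||c propc dome'] := IHn e'.
- rewrite -ltnS; apply: leq_trans le_n; rewrite ltnS; apply: proper_card.
  apply/properP; split.
    by apply/subsetP => p; rewrite !inE => /andP[].
  by exists (x, y); rewrite !inE //= /e' /same_pair !eqxx.
- by move=> u v; rewrite /e' same_pairC sym_e.
- by move=> u; rewrite /e' irr_e andbF.
- move=> u; apply: leq_ltn_trans (deg u); apply: subset_leq_card.
  by apply/subsetP => v; rewrite !inE => /andP[].
have cxy : c x y = None.
  by case: (c x y) (dome' x y) => //; rewrite /e' /same_pair !eqxx.
have [|c' [propc' domc']] := vizing_extend propc xy cxy.
  move=> u; apply: leq_ltn_trans (deg u); apply: subset_leq_card.
  by apply/subsetP => v; rewrite !inE dome' => /andP[].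
exists c' => // u v; rewrite domc' dome' /e'.
case: (boolP (same_pair x y u v)) => //= /orP[]/andP[/eqP-> /eqP->] //.
by rewrite sym_e.
Qed.

End EdgeColouring.

Local Open Scope ring_scope.

(** * Heavy matchings and cluster cuts *)

Lemma set2_inj (T : finType) (u v x y : T) :
  [set u; v] = [set x; y] -> u = x /\ v = y \/ u = y /\ v = x.
Proof.
move=> E; have mem z : (z == u) || (z == v) = (z == x) || (z == y).
  by have := congr1 (fun B : {set T} => z \in B) E; rewrite !inE.
have := mem u; have := mem v; have := mem x; have := mem y; rewrite !eqxx !orbT /=.
move=> /orP[]/eqP Dy /orP[]/eqP Dx _ _; subst; auto.
  have := mem v; rewrite !eqxx orbT orbb => /esym/eqP ->; auto.
have := mem u; rewrite !eqxx orbb => /esym/eqP ->; auto.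
Qed.

Lemma ler_sum_sub (R : numDomainType) (I : finType) (P Q : pred I) (F : I -> R) :
    (forall i, 0 <= F i) -> (forall i, P i -> Q i) ->
  \sum_(i | P i) F i <= \sum_(i | Q i) F i.
Proof.
move=> F_ge0 PQ; rewrite [leLHS]big_mkcond [leRHS]big_mkcond; apply: ler_sum => i _.
by case: ifP => [/PQ -> //|_]; case: ifP.
Qed.

(** The heaviest of the [k.+1] colour classes given by Vizing's theorem. A matching is encoded as an
    involution whose fixed points are the unmatched vertices. *)
Lemma heavy_matching (R : realDomainType) (T : finType) (e : rel T) (k : nat)
    (W : T * T -> R) : symmetric e -> irreflexive e ->
    (forall u, (#|[set v | e u v]| <= k)%N) -> (forall p, 0 <= W p) ->
  exists m : T -> T, [/\ involutive m, forall u, m u != u -> e u (m u) &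
    \sum_(p | e p.1 p.2) W p <=
      k.+1%:R * \sum_(p | e p.1 p.2 && (p.2 == m p.1)) W p].
Proof.
move=> sym_e irr_e deg W_ge0.
have [c [symc irrc injc] domc] : exists2 c : T -> T -> option 'I_k.+1,
    proper_colouring c & forall u v, c u v = e u v :> bool.
  by apply: vizing => // u; rewrite card_ord ltnS.
pose S i := \sum_(p | c p.1 p.2 == Some i) W p.
have S_ge0 i : 0 <= S i by apply: sumr_ge0.
have [i maxS] : exists i, forall j, S j <= S i.
  by case: (@arg_maxP _ _ _ ord0 predT S) => // i _ maxS; exists i => j; apply: maxS.
pose m u := odflt u [pick v | c u v == Some i].
have mP u v : c u v = Some i -> m u = v.
  move=> cuv; rewrite /m; case: pickP => [w /eqP cuw|/(_ v)]; last first.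
    by rewrite cuv eqxx.
  exact: injc cuw cuv.
exists m; split.
- move=> u; rewrite {2}/m; case: pickP => [v /eqP cuv|cu] /=.
    by apply: mP; rewrite symc.
  by rewrite /m; case: pickP => // v; rewrite cu.
- move=> u; rewrite /m; case: pickP => [v /eqP cuv _|]; last by rewrite eqxx.
  by rewrite -domc cuv.
have -> : \sum_(p | e p.1 p.2) W p = \sum_j S j.
  rewrite (partition_big (fun p => odflt i (c p.1 p.2)) predT) //=.
  apply: eq_bigr => j _; apply: eq_bigl => p; rewrite -domc.
  by case: (c p.1 p.2).
have -> : \sum_(p | e p.1 p.2 && (p.2 == m p.1)) W p = S i.
  apply: eq_bigl => p; rewrite -domc; apply/idP/eqP => [|cp]; last first.
    by rewrite cp (mP _ _ cp) eqxx.
  case cp: (c p.1 p.2) => [j|//] /= /eqP; rewrite /m.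
  case: pickP => [v /eqP cv /= pv|_ /= E]; first by rewrite -cp pv cv.
  by rewrite E irrc in cp.
apply: (@le_trans _ _ (\sum_(j < k.+1) S i)); first exact: ler_sum.
by rewrite sumr_const card_ord mulr_natl.
Qed.

(** * Cuts by random flips of clusters *)

Section Cuts.
Variables (G : sgraph) (R : realType) (w : {set G} -> R).
Hypothesis w_ge0 : nonneg_weights w.

(** Sums over ordered pairs count each edge twice; the value 0 off the edges lets them range over
    all pairs. *)
Definition pair_weight (p : G * G) : R :=
  if adj p.1 p.2 then w [set p.1; p.2] else 0.

Lemma mem_edges (p : G * G) : adj p.1 p.2 -> [set p.1; p.2] \in @edges G.
Proof. by move=> ap; apply/imsetP; exists p; rewrite ?inE. Qed.

Lemma pair_weight_ge0 p : 0 <= pair_weight p.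
Proof.
by rewrite /pair_weight; case: ifP => // /mem_edges; apply: w_ge0.
Qed.

Lemma sum_pair_weight (P : pred {set G}) :
  \sum_(p : G * G | P [set p.1; p.2]) pair_weight p =
    2 * \sum_(f in @edges G | P f) w f.
Proof.
rewrite /pair_weight -big_mkcondr /=.
rewrite (partition_big (fun p : G * G => [set p.1; p.2])
           (fun f => (f \in @edges G) && P f)) /=; last first.
  by move=> p /andP[-> ap]; rewrite andbT; apply: mem_edges.
rewrite mulr_sumr; apply: eq_bigr => f /andP[/imsetP[[x y] /= axy ->] Pxy].
have xy : x != y by apply: contraTneq axy => ->; rewrite inE adj_irrefl.
rewrite inE in axy.
rewrite (bigD1 (x, y)) /= ?Pxy ?axy ?eqxx //.
rewrite (bigD1 (y, x)) /=; last first.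
  by rewrite setUC Pxy adj_sym axy eqxx xpair_eqE (negPf xy) andbF.
rewrite big1 ?addr0 => [|[u v] /= /andP[/andP[/andP[_ /eqP uv] nxy] nyx]].
  by rewrite [[set y; x]]setUC mulr2n mulrDl !mul1r.
by case/set2_inj: uv nxy nyx => -[-> ->]; rewrite eqxx.
Qed.

Lemma total_weight_pairs : 2 * total_weight w = \sum_p pair_weight p.
Proof.
rewrite (sum_pair_weight predT); congr (_ * _); apply: eq_bigl => f.
by rewrite andbT.
Qed.

Lemma cut_pairs_le_mac (A : {set G}) :
  \sum_(p | (p.1 \in A) != (p.2 \in A)) pair_weight p <= 2 * mac w.
Proof.
apply: (@le_trans _ _ (2 * cut_weight w A (~: A))); last first.
  by rewrite ler_pM2l // /mac (bigD1 A) //= le_max lexx.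
rewrite /cut_weight -sum_pair_weight le_eqVlt; apply/orP; left; apply/eqP.
apply: eq_bigl => -[u v] /=.
apply/idP/existsP => [uv|[x /andP[xA /existsP[y /andP[yA /eqP E]]]]].
  case: (boolP (u \in A)) uv => uA uv.
    exists u; rewrite uA; apply/existsP; exists v; rewrite inE eqxx andbT.
    by case: (v \in A) uv.
  exists v; move: uv; case: (v \in A) => //= _.
  by apply/existsP; exists u; rewrite inE uA setUC eqxx.
rewrite inE in yA.
by case/set2_inj: E => -[-> ->]; rewrite xA (negPf yA).
Qed.

(** Average over all [t], which says which clusters (fibres of [f]) have their colouring [s]
    flipped. The constant 4 is the 2 from the probability 1/2 times the 2 from ordered pairs. *)
Lemma cluster_cut (L : finType) (f : G -> L) (s : G -> bool) :
    (forall u v, adj u v -> f u = f v -> s u != s v) ->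
  \sum_p pair_weight p + \sum_(p | f p.1 == f p.2) pair_weight p <= 4 * mac w.
Proof.
move=> s_proper.
pose A (t : {ffun L -> bool}) := [set u | s u (+) t (f u)].
pose N := #|{ffun L -> bool}|.
have N_gt0 : (0 < N)%N by apply/card_gt0P; exists [ffun=> false].
pose cut t (p : G * G) := (p.1 \in A t) != (p.2 \in A t).
(* An edge is cut by all [N] flips if it lies inside a cluster and by exactly half of them
   otherwise. *)
have avg p : pair_weight p *+ (2 * #|[pred t | cut t p]|) =
    pair_weight p *+ (N + (f p.1 == f p.2) * N).
  case: p => u v; rewrite /pair_weight /=.
  case: ifP => [auv|_]; last by rewrite !mul0rn.
  congr (_ *+ _); rewrite /cut /=; case: eqVneq => [fuv|nfuv].
    rewrite mul1n addnn -mul2n; congr (_ * _)%N; apply: eq_card => t.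
    rewrite !inE fuv; have := s_proper u v auv fuv.
    by case: (s u) (s v) (t (f v)) => [] [] [].
  (* Flipping the cluster of [u] alone exchanges the choices that cut the edge with those that do
     not. *)
  pose flip (t : {ffun L -> bool}) := [ffun l => t l (+) (l == f u)].
  have flipK : involutive flip.
    by move=> t; apply/ffunP => l; rewrite !ffunE -addbA addbb addbF.
  have cut_flip t : ((u \in A (flip t)) != (v \in A (flip t))) =
      ~~ ((u \in A t) != (v \in A t)).
    rewrite !inE !ffunE eqxx (eq_sym (f v)) (negPf nfuv).
    by case: (s u) (s v) (t (f u)) (t (f v)) => [] [] [] [].
  rewrite mul0n addn0 mul2n -addnn /N.
  rewrite -(cardC [pred t | (u \in A t) != (v \in A t)]).
  congr (_ + _)%N; rewrite -(card_image (inv_inj flipK)); apply: eq_card => t.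
  rewrite -[in LHS](flipK t) mem_image; last exact: inv_inj.
  exact: cut_flip.
have cut_le t : \sum_(p | cut t p) pair_weight p <= 2 * mac w.
  exact: cut_pairs_le_mac.
have := ler_sum (index_enum _) (fun t (_ : predT t) => cut_le t).
rewrite (exchange_big_dep predT) //= sumr_const -/N => le_mac.
have N_gt0R : 0 < N%:R :> R by rewrite ltr0n.
rewrite -(ler_pM2l N_gt0R).
have -> : N%:R * (4 * mac w) = 2 * ((2 * mac w) *+ N).
  by rewrite -[_ *+ N]mulr_natl; ring.
apply: (@le_trans _ _ (2 * (\sum_p \sum_(t | cut t p) pair_weight p))).
  rewrite mulrDr [X in _ + _ * X]big_mkcond !mulr_sumr -big_split /=.
  rewrite le_eqVlt; apply/orP; left; apply/eqP/eq_bigr => p _.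
  by rewrite sumr_const mulr_natl -mulrnA mulnC avg mulrnDr !mulr_natl mulrnA mulrb.
by rewrite ler_pM2l.
Qed.
End Cuts.

(** * Two-colourings of clusters of at most four vertices *)

Section SmallClusters.
Variable G : sgraph.
Hypothesis tfG : triangle_free G.

Definition two_colours (U : {set G}) (s : {ffun G -> bool}) :=
  [forall u in U, forall v in U, adj u v ==> (s u != s v)].

Lemma two_coloursP (U : {set G}) (s : {ffun G -> bool}) : reflect
  (forall u v, u \in U -> v \in U -> adj u v -> s u != s v) (two_colours U s).
Proof.
apply: (iffP forall_inP) => [h u v uU vU auv|h u uU].
  by have /forall_inP/(_ v vU)/implyP := h u uU; apply.
by apply/forall_inP => v vU; apply/implyP; apply: h.
Qed.

(* A vertex with two neighbours in [U] has at most one non-neighbour there, so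
   its neighbourhood and the complement are independent; if there is no such
   vertex then [U] induces a matching. *)
Lemma two_colours_exists (U : {set G}) : (#|U| <= 4)%N ->
  exists s, two_colours U s.
Proof.
move=> U4; pose N a := [set v in U | adj a v].
have [/existsP[a /andP[aU Na2]]|small] :=
  boolP [exists a, (a \in U) && (1 < #|N a|)%N].
  exists [ffun u => adj a u]; apply/two_coloursP => u v uU vU auv; rewrite !ffunE.
  apply/eqP => auav; case: (boolP (adj a u)) => au.
    by have := tfG a u v; rewrite au auv -auav au.
  have av : ~~ adj a v by rewrite -auav.
  (* Three vertices outside [N a] and at least two inside it are too many for [U]. *)
  have uva : [set u; v; a] \subset U :\: N a.
    apply/subsetP => z; rewrite !inE => /orP[/orP[]|] /eqP->.
    - by rewrite uU (negPf au).
    - by rewrite vU (negPf av).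
    - by rewrite aU adj_irrefl.
  have uv : u != v by apply: contraTneq auv => ->; rewrite adj_irrefl.
  have ua : u != a by apply: contraNneq av => <-.
  have va : v != a by apply: contraNneq au => <-; rewrite adj_sym.
  have := subset_leq_card uva.
  have -> : #|[set u; v; a]| = 3%N.
    by rewrite setUC cardsU1 cards2 !inE uv ![a == _]eq_sym (negPf ua) (negPf va).
  have NU : N a \subset U by apply/subsetP => z; rewrite inE => /andP[].
  rewrite cardsDS // leq_subRL ?subset_leq_card // => NU3.
  by have := leq_trans (leq_add Na2 (leqnn 3)) (leq_trans NU3 U4).
have uniqN a u v : a \in U -> u \in U -> v \in U -> adj a u -> adj a v -> u = v.
  move=> aU uU vU au av; apply: contraNeq small => uv; apply/existsP; exists a.
  rewrite aU; apply/card_gt1P; exists u, v.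
  by rewrite !inE uU vU.
(* In an induced matching, the end of smaller rank of each edge gets [true]. *)
exists [ffun u => [exists v in U, adj u v && (enum_rank u < enum_rank v)%N]].
apply/two_coloursP.
have side u v : u \in U -> v \in U -> adj u v ->
    [exists z in U, adj u z && (enum_rank u < enum_rank z)%N]
      = (enum_rank u < enum_rank v)%N.
  move=> uU vU auv; apply/exists_inP/idP => [[z zU /andP[auz]]|lt_uv].
    by rewrite (uniqN u z v).
  by exists v; rewrite // auv.
move=> u v uU vU auv; rewrite !ffunE (side u v) // (side v u) // 1?adj_sym //.
have : enum_rank u != enum_rank v.
  by apply: contraTneq auv => /enum_rank_inj ->; rewrite adj_irrefl.
by rewrite -(inj_eq val_inj) /=; case: ltngtP.
Qed.

(** A cluster is contained in its label, as [u \in f u], so a two-colouring of the label colours the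
    whole cluster. *)
Lemma small_cluster_cut (R : realType) (w : {set G} -> R) (f : G -> {set G}) :
    (forall u, u \in f u) -> (forall u, (#|f u| <= 4)%N) ->
  \sum_p pair_weight w p + \sum_(p : G * G | f p.1 == f p.2) pair_weight w p
    <= 4 * mac w.
Proof.
move=> f_in f4.
have ex_s u : exists s, two_colours (f u) s by apply: two_colours_exists.
pose s u := odflt [ffun=> false] [pick t | two_colours (f u) t] u.
apply: (@cluster_cut _ _ _ _ f s) => u v auv fuv; rewrite /s -fuv.
case: pickP => [t /two_coloursP t_ok /=|no]; last first.
  by case: (ex_s u) => t; rewrite no.
by apply: t_ok; rewrite ?f_in // fuv.
Qed.

End SmallClusters.

(** * Heavy clusters from two successive matchings *)

Section HeavyClusters.
Variables (G : sgraph) (R : realType) (w : {set G} -> R) (D : nat).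
Hypothesis w_ge0 : nonneg_weights w.
Hypothesis D_gt0 : (0 < D)%N.
Hypothesis deg : forall u : G, (#|neighbours u| <= D)%N.
Let W := pair_weight w.

Let W_ge0 p : 0 <= W p. Proof. exact: pair_weight_ge0. Qed.

Section Contraction.
Variable m : G -> G.
Hypothesis mK : involutive m.
Hypothesis m_adj : forall u, m u != u -> adj u (m u).

Definition block u : {set G} := [set u; m u].

(** The contracted graph lives on all of [{set G}]; sets that are not blocks are isolated
    vertices. *)
Definition block_adj : rel {set G} := fun P Q => (P != Q) &&
  [exists p : G * G, [&& block p.1 == P, block p.2 == Q & adj p.1 p.2]].

Lemma block_eq u v : v \in block u -> block v = block u.
Proof. by rewrite !inE => /orP[]/eqP-> //; rewrite /block mK setUC. Qed.

Lemma block_adj_sym : symmetric block_adj.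
Proof.
move=> P Q; rewrite /block_adj eq_sym; congr (_ && _).
by apply/existsP/existsP => -[p /and3P[h1 h2 h3]]; exists (p.2, p.1);
  rewrite /= h1 h2 adj_sym.
Qed.

(** Each end of a matched pair has at most [D.-1] neighbours besides its partner; an unmatched
    vertex has at most [D], which is at most [2 * D.-1] as [1 < D]. *)
Lemma block_degree P : (1 < D)%N -> (#|[set Q | block_adj P Q]| <= 2 * D.-1)%N.
Proof.
move=> D_gt1.
have [/existsP[u /eqP Pu]|noP] := boolP [exists u, block u == P]; last first.
  rewrite (_ : [set Q | _] = set0) ?cards0 //; apply/setP => Q; rewrite !inE.
  apply: contraNF noP => /andP[_ /existsP[p /and3P[bp _ _]]].
  by apply/existsP; exists p.1.
pose N := if m u == u then neighbours u
          else (neighbours u :\ m u) :|: (neighbours (m u) :\ u).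
apply: (@leq_trans #|N|).
  apply: leq_trans (leq_imset_card block N); apply/subset_leq_card/subsetP => Q.
  rewrite inE => /andP[PQ /existsP[[x y] /= /and3P[/eqP xP /eqP yQ axy]]].
  apply/imsetP; exists y => //; rewrite /N.
  have xu : x \in block u by rewrite Pu -xP !inE eqxx.
  have yNu : y \notin block u.
    by apply: contraNN PQ => /block_eq yu; rewrite -yQ yu Pu.
  move: xu yNu; rewrite !inE => xu /norP[yu ymu].
  case: (eqVneq (m u) u) => mu.
    by move: xu; rewrite mu orbb => /eqP <-; rewrite inE.
  by rewrite !inE yu ymu /=; case/orP: xu => /eqP <-; rewrite axy ?orbT.
rewrite /N; case: eqVneq => [_|mu].
  apply: leq_trans (deg u) _; case: (D) D_gt1 => [|[|d]] //= _.
  by rewrite mul2n -addnn addnS ltnS leq_addr.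
apply: leq_trans (leq_card_setU _ _) _; rewrite mul2n -addnn leq_add //.
  rewrite -ltnS prednK //; apply: leq_trans (deg u).
  by rewrite [leqRHS](cardsD1 (m u)) inE m_adj.
rewrite -ltnS prednK //; apply: leq_trans (deg (m u)).
by rewrite [leqRHS](cardsD1 u) inE adj_sym m_adj.
Qed.

Lemma heavy_contracted_matching : (1 < D)%N ->
  exists m2 : {set G} -> {set G}, [/\ involutive m2,
    forall P, m2 P != P -> block_adj P (m2 P) &
    \sum_(p | block p.1 != block p.2) W p <= (2 * D.-1).+1%:R *
      \sum_(p | (block p.1 != block p.2) && (block p.2 == m2 (block p.1))) W p].
Proof.
move=> D_gt1; pose bb (p : G * G) := (block p.1, block p.2).
(* Edges that become parallel under contraction are merged and their weights added. *)
pose W2 (q : {set G} * {set G}) := \sum_(p | bb p == q) W p.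
have irr : irreflexive block_adj by move=> P; rewrite /block_adj eqxx.
have deg2 P := block_degree P D_gt1.
have W2_ge0 q : 0 <= W2 q by apply: sumr_ge0.
have [m2 [m2K m2_adj]] := heavy_matching block_adj_sym irr deg2 W2_ge0.
have sumW2 (Q : pred ({set G} * {set G})) :
    \sum_(q | block_adj q.1 q.2 && Q q) W2 q =
    \sum_(p | (block p.1 != block p.2) && Q (bb p)) W p.
  transitivity (\sum_(p | block_adj (block p.1) (block p.2) && Q (bb p)) W p).
    rewrite [RHS](partition_big bb (fun q => block_adj q.1 q.2 && Q q)) //=.
    apply: eq_bigr => q Pq; apply: eq_bigl => p.
    by case: eqP => [E|_]; rewrite ?andbF // andbT; rewrite -E in Pq.
  (* A pair in distinct blocks that are not adjacent is not an edge of [G] and weighs 0. *)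
  rewrite [LHS]big_mkcond [RHS]big_mkcond; apply: eq_bigr => p _.
  rewrite /block_adj; case: eqVneq => //= _; case: existsP => //= no.
  case: ifP => // _; rewrite /W /pair_weight; case: ifP => // ap.
  by case: no; exists p; rewrite !eqxx.
have := sumW2 predT; rewrite /=.
under eq_bigl do rewrite andbT; under [RHS]eq_bigl do rewrite andbT.
by move=> ->; rewrite (sumW2 (fun q => q.2 == m2 q.1)) => ?; exists m2.
Qed.

End Contraction.

Lemma heavy_clusters : exists f : G -> {set G},
  [/\ forall u, u \in f u, forall u, (#|f u| <= 4)%N &
    (3 * D%:R - 1) * (\sum_p W p) <=
      (2 * D%:R - 1) * (D%:R + 1) * \sum_(p | f p.1 == f p.2) W p].
Proof.
case: (ltngtP 1 D) => [D_gt1|D_lt1|D1]; last first.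
(* For [D = 1] the edges are disjoint: closed neighbourhoods are the clusters and every edge lies
   inside one. *)
- exists (fun u => u |: neighbours u); split=> [u|u|].
  + exact: setU11.
  + by rewrite cardsU1 (leq_trans (leq_add (leq_b1 _) (deg u))) // -D1.
  + rewrite -D1 !mulr1 (_ : 3 - 1 = (2 - 1) * (1 + 1) :> R); last by ring.
    rewrite ler_pM2l; last by lra.
    rewrite [leRHS]big_mkcond; apply: ler_sum => -[u v] _ /=; case: eqP => // nuv.
    rewrite /W /pair_weight /=; case: ifP => // auv; case: nuv.
    have N1 (x y : G) : adj x y -> neighbours x = [set y].
      move=> axy; apply/esym/eqP; rewrite eqEcard cards1 sub1set inE axy /=.
      by apply: leq_trans (deg x) _; rewrite D1.
    by rewrite (N1 u v) // (N1 v u) 1?adj_sym // setUC.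
- by rewrite ltnNge D_gt0 in D_lt1.
have [m [mK m_adj heavy1]] :=
  heavy_matching (@adj_sym G) (@adj_irrefl G) deg W_ge0.
have [m2 [m2K m2_adj heavy2]] := heavy_contracted_matching mK m_adj D_gt1.
(* Two matched blocks receive the same label because [m2] is an involution; an unmatched block is
   its own label. *)
pose b := block m; pose f u := b u :|: m2 (b u).
have b2 u : (#|b u| <= 2)%N by rewrite cards2; case: (_ == _).
exists f; split=> [u|u|].
- by rewrite !inE eqxx.
- apply: leq_trans (leq_card_setU _ _) (leq_add (n1 := 2) (n2 := 2) _ _) => //.
  (* If [m2] moves the block, its image is adjacent to it and hence is again a block, not an
     arbitrary set. *)
  have [->//|/m2_adj/andP[_ /existsP[p /and3P[_ /eqP <- _]]]] :=
    eqVneq (m2 (b u)) (b u).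
  exact: b2.
set T0 := \sum_p W p; set F0 := \sum_(p | _) W p.
set M0 := \sum_(p | b p.1 == b p.2) W p.
set M2 := \sum_(p | (b p.1 != b p.2) && (b p.2 == m2 (b p.1))) W p.
have T0E : T0 = M0 + \sum_(p | b p.1 != b p.2) W p.
  by rewrite /T0 (bigID (fun p => b p.1 == b p.2)).
have ge1 : T0 <= D.+1%:R * M0.
  apply: le_trans (le_trans heavy1 _).
    rewrite [leRHS]big_mkcond; apply: ler_sum => p _.
    by rewrite /W /pair_weight; case: ifP.
  rewrite ler_pM2l ?ltr0n //; apply: ler_sum_sub => // p /andP[_ /eqP E].
  by rewrite /b E (@block_eq m mK p.1) // !inE eqxx orbT.
have ge2 : T0 - M0 <= (2 * D.-1).+1%:R * M2.
  by rewrite T0E addrC addKr.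
have ge3 : M0 + M2 <= F0.
  rewrite /F0 (bigID (fun p => b p.1 == b p.2)) /=; apply: lerD; apply: ler_sum_sub => // p.
    by move=> /eqP E; rewrite /f E !eqxx.
  by case/andP=> -> /eqP E; rewrite /f E m2K setUC eqxx.
(* The bound [M0 + (T0 - M0) / (2 D - 1)] grows with [M0], so the worst case is [M0 = T0 / (D + 1)],
   which gives the ratio [(3 D - 1) / ((2 D - 1) (D + 1))]. The variable [d] stands for [D - 1]. *)
have D_R : D%:R = D.-1%:R + 1 :> R by rewrite natr1 prednK.
move: ge1 ge2; rewrite -!natr1 natrM D_R.
move: (D.-1%:R : R) (ler0n R D.-1) => d d_ge0.
nra.
Qed.

End HeavyClusters.

Theorem theorem5p12 (R : realType) (Delta : nat) (G : sgraph) (w : {set G} -> R)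
    (hDelta : (0 < Delta)%N) (hconn : connected G) (hfree : triangle_free G)
    (hw : nonneg_weights w) (hdeg : (max_degree G <= Delta)%N) :
  t_bound R Delta * total_weight w <= mac w.
Proof.
have deg (u : G) : (#|neighbours u| <= Delta)%N.
  by apply: leq_trans hdeg; apply: leq_bigmax.
have [f [f_in f4 heavy]] := heavy_clusters hw hDelta deg.
have := small_cluster_cut hfree w f_in f4; move: heavy.
rewrite -total_weight_pairs; set F := \sum_(p | _) _ => heavy cut.
have D1 : 1 <= Delta%:R :> R by rewrite ler1n.
rewrite /t_bound; set d := Delta%:R in heavy D1 *.
have den : 0 < (2 * d - 1) * (d + 1) by apply: mulr_gt0; lra.
(* The denominator factors as [2 (2 d - 1) (d + 1)], which exposes half the ratio of [heavy]. *)
have -> : 1 / 2 + (3 * d - 1) / (4 * d ^+ 2 + 2 * d - 2) =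
    1 / 2 + (3 * d - 1) / ((2 * d - 1) * (d + 1)) / 2.
  by field; rewrite !gt_eqF //; nra.
have : (3 * d - 1) / ((2 * d - 1) * (d + 1)) * (2 * total_weight w) <= F.
  by rewrite mulrAC ler_pdivrMr // [F * _]mulrC.
set t := _ / (_ * _); lra.
Qed.
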